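(* For every nonempty relational similarity type $t$ and every infinite set $V$ of variables, first-order logic $\mathcal{FOL}_t(V)$ is conditionally substitutional.
   Context: A logic is a tuple $\mathcal L=\langle F,M,\mathrm{mng},\models\rangle$ with connectives $\mathrm{Cn}$, atomic formulas $P$, formula algebra $\mathfrak F=\mathfrak F(P,\mathrm{Cn})$ with universe $F$ (term algebra), class of models $M$, validity $\models\subseteq M\times F$, and for each model $\mathfrak M$ a homomorphism $\mathrm{mng}_{\mathfrak M}$ from $\mathfrak F$ into an algebra of type $\mathrm{Cn}$ (equal meanings preserve validity). Tautological congruence $\sim_{\mathcal L}=\bigcap_{\mathfrak M}\ker(\mathrm{mng}_{\mathfrak M})$. $\mathcal L$ is conditionally substitutional if for every endomorphism $s$ of $\mathfrak F$ and every $\mathfrak M\in M$: if $\sim_{\mathcal L}\subseteq\ker(\mathrm{mng}_{\mathfrak M}\circ s)$ then there is $\mathfrak N\in M$ with $\mathrm{mng}_{\mathfrak N}(p)=\mathrm{mng}_{\mathfrak M}(s(p))$ for all $p\in P$. First-order logic $\mathcal{FOL}_t(V)$, for a relational similarity type $t$ (relation symbols $r$ with arities $t(r)\ge1$) and set $V$ of variables: atomic formulas $P_t(V)=\{r(v_1,\dots,v_n): r\in\mathrm{dom}(t), t(r)=n, v_1,\dots,v_n\in V\}$; connectives: binary $\wedge$, unary $\neg$ and $\exists v$ ($v\in V$), constants $\bot$ and $v=w$ ($v,w\in V$); models: $t$-structures $\mathfrak M=\langle M,r^{\mathfrak M}\rangle_{r\in\mathrm{dom}(t)}$ with the usual satisfaction;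 $\mathrm{mng}_{\mathfrak M}(\phi)=\{h\in{}^VM:\mathfrak M\models\phi[h]\}$ (algebra of sets of assignments with the induced operations); $\mathfrak M\models\phi$ iff $\phi$ is satisfied in $\mathfrak M$ under all assignments. *)

(* Defs.v *)
From mathcomp Require Import all_boot.
From mathcomp Require Import boolp classical_sets functions cardinality.
Set Implicit Arguments.
Unset Strict Implicit.
Unset Printing Implicit Defensive.
Local Open Scope classical_set_scope.

Record signature := Signature { conn : Type; conn_arity : conn -> nat }.

(** The universe of an algebra is a subset of an ambient type [D], so that
    elements of two different algebras over [D] can be compared for equality,
    as in set theory. *)
Record algebra (S : signature) (D : Type) := Algebra {
  universe : set D;
  op : forall c : conn S, ('I_(conn_arity c) -> D) -> D;
  op_closed : forall (c : conn S) (x : 'I_(conn_arity c) -> D),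
    (forall i, universe (x i)) -> universe (op x) }.

Definition is_hom (S : signature) (D E : Type) (A : algebra S D)
    (B : algebra S E) (f : D -> E) : Prop :=
  (forall x, universe A x -> universe B (f x)) /\
  (forall (c : conn S) (x : 'I_(conn_arity c) -> D),
    (forall i, universe A (x i)) -> f (op A x) = op B (fun i => f (x i))).

Inductive formula (S : signature) (P : Type) : Type :=
| Atom of P
| App (c : conn S) of 'I_(conn_arity c) -> formula S P.

Arguments Atom {S P} p.
Arguments App {S P} c x.

Definition formula_algebra (S : signature) (P : Type) :
    algebra S (formula S P) :=
  @Algebra S (formula S P) setT (@App S P) (fun _ _ _ => I).

Record logic := Logic {
  Cn : signature;
  atoms : Type;
  model : Type;
  valid : model -> formula Cn atoms -> Prop;
  meaning : Type;
  mng_algebra : model -> algebra Cn meaning;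
  mng : model -> formula Cn atoms -> meaning;
  mng_hom : forall M, is_hom (formula_algebra Cn atoms) (mng_algebra M) (mng M);
  mng_valid : forall M phi psi,
    mng M phi = mng M psi -> valid M phi -> valid M psi }.

Definition form (L : logic) : Type := formula (Cn L) (atoms L).

Definition form_algebra (L : logic) : algebra (Cn L) (form L) :=
  formula_algebra (Cn L) (atoms L).

Definition ker (A B : Type) (f : A -> B) : A -> A -> Prop :=
  fun x y => f x = f y.

Definition taut_congruence (L : logic) : form L -> form L -> Prop :=
  fun phi psi => forall M : model L, ker (mng M) phi psi.

Definition conditionally_substitutional (L : logic) : Prop :=
  forall s : form L -> form L, is_hom (form_algebra L) (form_algebra L) s ->
  forall M : model L,
    (forall phi psi, taut_congruence phi psi ->
       ker (fun chi => mng M (s chi)) phi psi) ->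
    exists N : model L,
      forall p : atoms L, mng N (Atom p) = mng M (s (Atom p)).

Record similarity_type := SimilarityType {
  rel_symbol : Type;
  arity : rel_symbol -> nat;
  arity_gt0 : forall r, 0 < arity r }.

(** As usual in first-order logic, universes of structures are nonempty. *)
Record structure (t : similarity_type) := Structure {
  dom : Type;
  dom_inhabited : inhabited dom;
  interp : forall r : rel_symbol t, set ((arity r).-tuple dom) }.

Section FOL.
Variables (t : similarity_type) (V : Type).

Inductive fo_conn : Type :=
| And | Neg | Ex of V | Bot | Eq of V & V.

Definition fo_conn_arity (c : fo_conn) : nat :=
  match c with
  | And => 2 | Neg => 1 | Ex _ => 1 | Bot => 0 | Eq _ _ => 0
  end.

Definition fo_signature : signature := Signature fo_conn_arity.

Definition fo_atom : Type := {r : rel_symbol t & (arity r).-tuple V}.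

Definition fo_formula : Type := formula fo_signature fo_atom.

Definition agree_off (A : Type) (v : V) (h k : V -> A) : Prop :=
  forall w, w <> v -> h w = k w.

(** Tarski's clauses for the connectives; [S i] is the set of assignments
    satisfying the [i]-th immediate subformula. *)
Definition sat_conn (A : Type) (c : fo_conn) :
    ('I_(fo_conn_arity c) -> (V -> A) -> Prop) -> (V -> A) -> Prop :=
  match c with
  | And => fun S h => S ord0 h /\ S ord_max h
  | Neg => fun S h => ~ S ord0 h
  | Ex v => fun S h => exists k, agree_off v h k /\ S ord0 k
  | Bot => fun _ _ => False
  | Eq v w => fun _ h => h v = h w
  end.

Fixpoint sat (M : structure t) (phi : fo_formula) (h : V -> dom M) : Prop :=
  match phi with
  | Atom p => interp (map_tuple h (projT2 p))
  | App c x => @sat_conn (dom M) c (fun i => sat (x i)) h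
  end.

(** An assignment packed with its codomain, so that sets of assignments into
    the universes of different structures inhabit one type and can be compared;
    in particular there is a single empty set. *)
Record assignment := Assignment { codom : Type; afun : V -> codom }.

Definition all_assignments (M : structure t) : set assignment :=
  [set Assignment h | h in [set: V -> dom M]].

Definition fo_mng (M : structure t) (phi : fo_formula) : set assignment :=
  [set Assignment h | h in [set h : V -> dom M | sat phi h]].

Definition fo_op (M : structure t) (c : fo_conn) :
    ('I_(fo_conn_arity c) -> set assignment) -> set assignment :=
  match c with
  | And => fun X => X ord0 `&` X ord_max
  | Neg => fun X => all_assignments M `\` X ord0
  | Ex v => fun X =>
      [set Assignment h | h in [set h : V -> dom M |
         exists k : V -> dom M, agree_off v h k /\ X ord0 (Assignment k)]]
  | Bot => fun _ => set0
  | Eq v w => fun _ =>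
      [set Assignment h | h in [set h : V -> dom M | h v = h w]]
  end.

Lemma fo_op_closed (M : structure t) (c : conn fo_signature)
    (X : 'I_(conn_arity c) -> set assignment) :
  (forall i, X i `<=` all_assignments M) ->
  @fo_op M c X `<=` all_assignments M.
Proof.
case: c X => [||v||v w] X XM a /=.
- by case=> + _; exact: XM.
- by case.
- by case=> h _ <-; exists h.
- by [].
- by case=> h _ <-; exists h.
Qed.

Definition fo_algebra (M : structure t) :
    algebra fo_signature (set assignment) :=
  @Algebra fo_signature (set assignment)
    [set X | X `<=` all_assignments M] (@fo_op M) (@fo_op_closed M).

Lemma Assignment_inj (A : Type) : injective (@Assignment A).
Proof.
move=> h k e.
have key : forall a b : assignment, a = b ->
    exists e : codom a = codom b,
      eq_rect _ (fun B => V -> B) (afun a) _ e = afun b.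
  by move=> a _ <-; exists erefl.
by have [/= e'] := key _ _ e; rewrite (Prop_irrelevance e' erefl).
Qed.

Lemma fo_mngE (M : structure t) (phi : fo_formula) (h : V -> dom M) :
  fo_mng M phi (Assignment h) <-> sat phi h.
Proof.
split; first by case=> k + /Assignment_inj <-.
by move=> s; exists h.
Qed.

Lemma fo_mng_hom (M : structure t) :
  is_hom (formula_algebra fo_signature fo_atom) (fo_algebra M) (fo_mng M).
Proof.
split=> [phi _ a [h _ <-]|c x _]; first by exists h.
apply/seteqP; split=> a.
- case=> h /= + <-; case: c x => [||v||v w] x /=.
  + by case=> s0 s1; split; apply/fo_mngE.
  + by move=> s0; split; [exists h | move/fo_mngE].
  + by case=> k [hk s0]; exists h => //; exists k; split=> //; apply/fo_mngE.
  + by [].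
  + by move=> e; exists h.
- case: c x => [||v||v w] x /=.
  + by case=> -[h s0 <-] /fo_mngE s1; exists h.
  + by case=> -[h _ <-] s0; exists h => //= s; apply/s0/fo_mngE.
  + by case=> h [k [hk /fo_mngE s0]] <-; exists h => //; exists k.
  + by [].
  + by case=> h e <-; exists h.
Qed.

Definition fo_valid (M : structure t) (phi : fo_formula) : Prop :=
  forall h : V -> dom M, sat phi h.

Lemma fo_mng_valid (M : structure t) (phi psi : fo_formula) :
  fo_mng M phi = fo_mng M psi -> fo_valid M phi -> fo_valid M psi.
Proof. by move=> e + h => /(_ h) /fo_mngE; rewrite e => /fo_mngE. Qed.

Definition FOL : logic := Logic fo_mng_hom fo_mng_valid.

End FOL.

(* Main.v *)
(** The candidate model [N] lives on the universe of [M]; its relation [r] holds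
    of [a] when some [r(w)] has an image [s (r(w))] true in [M] at an assignment
    sending [w] to [a].  Two tautologies show that the choice of [w] and of the
    assignment is irrelevant.  Since [r(w)] is equivalent to [exists u, r(w)]
    for [u] not in [w], the value of [s (r(w))] is unaffected by changing a
    variable outside [w], hence depends on [w] only, as a formula has finitely
    many variables.  Since [w = u] makes [r(w)] and [r(u)] equivalent, any two
    tuples of variables are comparable through a fresh tuple [u], which exists
    as [V] is infinite. *)

Require Import Defs.
From mathcomp Require Import all_boot.
From mathcomp Require Import boolp classical_sets functions cardinality.
Local Open Scope classical_set_scope.

Set Implicit Arguments.
Unset Strict Implicit.
Unset Printing Implicit Defensive.

Definition fand (t : similarity_type) (V : Type) (phi psi : fo_formula t V) :
    fo_formula t V :=
  @App (fo_signature V) _ (And V) (fun i => if i == ord0 then phi else psi).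

Definition fex (t : similarity_type) (V : Type) (v : V) (phi : fo_formula t V) :
    fo_formula t V :=
  @App (fo_signature V) _ (Ex v) (fun _ => phi).

Definition feq (t : similarity_type) (V : Type) (v w : V) : fo_formula t V :=
  @App (fo_signature V) _ (Eq v w) (fun i => match notF (ltn_ord i) with end).

Definition guard (t : similarity_type) (V : Type) (l : seq (V * V))
    (phi : fo_formula t V) : fo_formula t V :=
  foldr (fun p => fand (feq t p.1 p.2)) phi l.

Definition fo_endo (t : similarity_type) (V : Type)
    (s : fo_formula t V -> fo_formula t V) : Prop :=
  is_hom (form_algebra (FOL t V)) (form_algebra (FOL t V)) s.

(** At the identity, [sat_endo_ex] and [sat_endo_guard] yield the plain semantics of [fex] and
    [guard], so one lemma serves both a formula and its image. *)
Lemma fo_endo_id (t : similarity_type) (V : Type) :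
  fo_endo (fun phi : fo_formula t V => phi).
Proof. by []. Qed.

Lemma fo_endo_App (t : similarity_type) (V : Type)
    (s : fo_formula t V -> fo_formula t V) (hs : fo_endo s)
    (c : conn (fo_signature V)) (x : 'I_(conn_arity c) -> fo_formula t V) :
  s (App c x) = App c (fun i => s (x i)).
Proof. exact: (proj2 hs c x (fun=> I)). Qed.

Lemma sat_endo_ex (t : similarity_type) (V : Type)
    (s : fo_formula t V -> fo_formula t V) (hs : fo_endo s)
    (M : structure t) (v : V) (phi : fo_formula t V) (h : V -> dom M) :
  sat (s (fex v phi)) h <-> exists k, agree_off v h k /\ sat (s phi) k.
Proof. by rewrite /fex (fo_endo_App hs). Qed.

Lemma sat_endo_guard (t : similarity_type) (V : Type)
    (s : fo_formula t V -> fo_formula t V) (hs : fo_endo s)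
    (M : structure t) (l : seq (V * V)) (phi : fo_formula t V)
    (h : V -> dom M) :
  sat (s (guard l phi)) h <->
  map h (unzip1 l) = map h (unzip2 l) /\ sat (s phi) h.
Proof.
elim: l => [|[v w] l IHl] /=; first by split=> [|[]].
rewrite /fand (fo_endo_App hs) /= /feq (fo_endo_App hs) /= IHl.
by split=> [[-> [-> ?]]|[[-> ->] ?]].
Qed.

Definition update (V : eqType) (A : Type) (h : V -> A) (v : V) (a : A) : V -> A :=
  fun w => if w == v then a else h w.

Lemma agree_off_update (V : eqType) (A : Type) (h : V -> A) (v : V) (a : A) :
  agree_off v h (update h v a).
Proof. by move=> w /eqP/negPf wv; rewrite /update wv. Qed.

Lemma finite_support (t : similarity_type) (V : eqType)
    (phi : fo_formula t V) :
  exists l : seq V, forall (M : structure t) (h k : V -> dom M),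
    {in l, h =1 k} -> sat phi h -> sat phi k.
Proof.
elim: phi => [[r v]|c x IHx] /=.
  exists (tval v) => M h k hk /=.
  suff -> : map_tuple h v = map_tuple k v by [].
  by apply: val_inj; apply/eq_in_map.
have [f fP] := choice IHx; case: c x IHx f fP => [||v||v w] x _ f fP.
- exists (f ord0 ++ f ord_max) => M h k hk /= [s0 s1].
  by split; [apply: fP s0|apply: fP s1] => v vf;
    apply: hk; rewrite mem_cat vf ?orbT.
- exists (f ord0) => M h k hk /= nh sk; apply: nh.
  by apply: fP sk => v vf; rewrite hk.
- exists (f ord0) => M h k hk /= [h' [hh' sh']].
  (* The witness for [k] copies only the value at [v] from the witness [h'] for [h]; elsewhere on
     the list, [h'], [h] and [k] agree. *)
  exists (update k v (h' v)); split; first exact: agree_off_update.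
  apply: fP sh' => w wf; rewrite /update; case: eqVneq => [-> //|/eqP wv].
  by rewrite -hh' // hk.
- by exists [::].
- by exists [:: v; w] => M h k hk /=; rewrite !hk // !inE eqxx ?orbT.
Qed.

(** [h] and [k] may differ at infinitely many variables, but only those in a finite support of [phi]
    matter, and these can be corrected one at a time. *)
Lemma sat_agree_on (t : similarity_type) (V : eqType) (M : structure t)
    (phi : fo_formula t V) (X : {pred V})
    (indep : forall (h k : V -> dom M) (u : V),
      u \notin X -> agree_off u h k -> sat phi h -> sat phi k)
    (h k : V -> dom M) (hk : {in X, h =1 k}) :
  sat phi h -> sat phi k.
Proof.
have [l lP] := finite_support phi.
(* [B] lists the variables of the support at which [h'] may still differ from [k]; each induction
   step corrects one of them. *)
suff H : forall (B : seq V) h', {in X, h' =1 k} ->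
    {in l, forall v, v \notin B -> h' v = k v} -> sat phi h' -> sat phi k.
  by apply: (H l h hk) => v ->.
elim=> [|u B IHB] h' h'k h'l sh'.
  by apply: lP sh' => v vl; apply: h'l.
apply: (IHB (update h' u (k u))).
- by move=> v vX; rewrite /update; case: eqVneq => [-> //|_]; apply: h'k.
- move=> v vl vB; rewrite /update; case: eqVneq => [-> //|vu].
  by apply: h'l; rewrite // inE negb_or vu.
have [uX|uX] := boolP (u \in X); last first.
  apply: (indep h' _ u) => //; exact: agree_off_update.
suff -> : update h' u (k u) = h' by [].
by apply: funext => v; rewrite /update; case: eqVneq => [->|//]; rewrite h'k.
Qed.

Lemma fresh_seq (V : choiceType) (V_infinite : infinite_set [set: V])
    (l : seq V) (n : nat) :
  exists u : n.-tuple V, uniq u /\ {in u, forall v, v \notin l}.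
Proof.
elim: n => [|n [u [uu ul]]]; first by exists [tuple].
have [v vlu] : exists v, v \notin l ++ u.
  apply: contrapT => /forallNP H; apply: V_infinite.
  apply: (@sub_finite_set _ _ [set` l ++ u]); last exact: finite_seq.
  by move=> v _ /=; apply: contrapT => /negP; apply: H.
move: vlu; rewrite mem_cat negb_or => /andP[vl vu].
exists [tuple of v :: u]; split; first by rewrite /= vu.
by move=> w; rewrite inE => /predU1P[->|/ul].
Qed.

Lemma extend_assignment (V : eqType) (A : Type) (n : nat) (u : n.-tuple V)
    (a : n.-tuple A) (h : V -> A) :
  uniq u -> exists h' : V -> A,
    map_tuple h' u = a /\ {in [predC u], h' =1 h}.
Proof.
(* The default [h v] is never reached, since the index of a member of [u] is below the common length
   of [u] and [a]. *)
move=> uu; exists (fun v => if v \in u then nth (h v) a (index v u) else h v).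
split; last by move=> v; rewrite inE /= => /negPf ->.
apply: eq_from_tnth => i; rewrite tnth_map mem_tnth.
by rewrite (tnth_nth (tnth u i)) index_uniq ?size_tuple // -tnth_nth.
Qed.

Lemma sat_endo_atom (t : similarity_type) (V : choiceType)
    (V_infinite : infinite_set [set: V])
    (s : fo_formula t V -> fo_formula t V) (hs : fo_endo s) (M : structure t)
    (hM : forall phi psi : fo_formula t V,
      (forall N : structure t, fo_mng N phi = fo_mng N psi) ->
      fo_mng M (s phi) = fo_mng M (s psi))
    (r : rel_symbol t) (v w : (arity r).-tuple V) (h k : V -> dom M) :
  map_tuple h v = map_tuple k w ->
  sat (s (Atom (existT _ r v))) h -> sat (s (Atom (existT _ r w))) k.
Proof.
pose at_ (x : (arity r).-tuple V) : fo_formula t V := Atom (existT _ r x).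
rewrite -/(at_ v) -/(at_ w).
(* The hypothesis [hM] in terms of satisfaction: [s] sends logically equivalent formulas to formulas
   equivalent in [M]. *)
have transfer phi psi : (forall N (g : V -> dom N), sat phi g <-> sat psi g) ->
    forall g : V -> dom M, sat (s phi) g <-> sat (s psi) g.
  move=> E g; rewrite -!fo_mngE; suff -> : fo_mng M (s phi) = fo_mng M (s psi) by [].
  apply: hM => N; congr image; apply/seteqP.
  by split=> g' /E.
have indep x (g g' : V -> dom M) : {in x, g =1 g'} ->
    sat (s (at_ x)) g -> sat (s (at_ x)) g'.
  apply: sat_agree_on => {}g {}g' u ux gg' sg.
  (* As [u] is not in [x], quantifying over [u] does not change the meaning of [at_ x]; after [s],
     the old assignment [g] witnesses the quantifier at [g']. *)
  apply/(transfer (fex u (at_ x))); last first.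
    apply/(sat_endo_ex hs); exists g; split=> // z /gg' -> //.
  move=> N f; rewrite (sat_endo_ex (@fo_endo_id t V)); split=> [[f' [ff' /=]]|sf].
    suff -> : map_tuple f x = map_tuple f' x by [].
    apply: val_inj; apply/eq_in_map => z zx; apply: ff' => zu.
    by rewrite -zu zx in ux.
  by exists f.
have rename x y (g : V -> dom M) : map_tuple g x = map_tuple g y ->
    sat (s (at_ x)) g -> sat (s (at_ y)) g.
  move=> /(congr1 val) /= gxy sx.
  have sz : size x = size y by rewrite !size_tuple.
  have U1 : unzip1 (zip x y) = x by rewrite unzip1_zip ?sz.
  have U2 : unzip2 (zip x y) = y by rewrite unzip2_zip ?sz.
  (* Under the equations [x = y] the two atoms are equivalent, and [s] leaves these equations
     unchanged because they are constants of the algebra. *)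
  suff : sat (s (guard (zip x y) (at_ y))) g by case/(sat_endo_guard hs).
  apply/(transfer (guard (zip x y) (at_ x))); last first.
    by apply/(sat_endo_guard hs); rewrite U1 U2.
  move=> N f; rewrite !(sat_endo_guard (@fo_endo_id t V)) U1 U2 /=.
  by split=> -[fxy]; have -> : map_tuple f x = map_tuple f y by apply: val_inj.
move=> hvkw; have [u [uu uvw]] := fresh_seq V_infinite (v ++ w) (arity r).
have disj z : z \in v ++ w -> z \in [predC u].
  by rewrite inE /= => zvw; apply/negP => /uvw; rewrite zvw.
have [h' [h'u h'h]] := extend_assignment (map_tuple h v) h uu.
have [k' [k'u k'k]] := extend_assignment (map_tuple h v) k uu.
have h'v : {in v, h' =1 h} by move=> z zv; apply/h'h/disj; rewrite mem_cat zv.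
have k'w : {in w, k' =1 k}.
  by move=> z zw; apply/k'k/disj; rewrite mem_cat zw orbT.
(* Truth travels from [v] at [h] to [v] at [h'], [u] at [h'], [u] at [k'], [w] at [k'] and finally
   [w] at [k]; the chain is built backwards. *)
move=> sv; apply: (indep w k') => //; apply: (rename u).
  by rewrite k'u hvkw; apply: val_inj; apply/esym/eq_in_map.
apply: (indep u h').
  by apply/eq_in_map; rewrite -[LHS]/(val (map_tuple h' u)) h'u -k'u.
apply: (rename v); last by apply: indep sv => z zv; rewrite h'v.
by rewrite h'u; apply: val_inj; apply/eq_in_map.
Qed.

Theorem theorem3p9 (t : similarity_type) (V : Type)
    (t_nonempty : inhabited (rel_symbol t))
    (V_infinite : infinite_set [set: V]) :
  conditionally_substitutional (FOL t V).
Proof.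
move=> s hs M hM.
exists (@Structure t (dom M) (dom_inhabited M) (fun r => [set a |
  exists (v : (arity r).-tuple V) (h : V -> dom M),
    map_tuple h v = a /\ sat (s (Atom (existT _ r v))) h])).
move=> [r v] /=; congr image; apply/seteqP; split=> h /=.
  (* [{classic V}] equips [V] with the classical equality test and choice needed for updates and
     fresh variables. *)
  by case=> w [k [kw]]; apply: (@sat_endo_atom t {classic V}).
by move=> sv; exists v, h.
Qed.
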